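(* Let $\varphi$ be the unique continuous solution of $$\varphi(x)=g_i\left(\varphi(Nx-i)\right),\qquad \tfrac iN\le x\le\tfrac{i+1}N,\ i\in\Sigma_N,$$ and let $\mu_\varphi$ be the probability measure on $[0,1]$ with distribution function $\varphi$. Assume $a_0<1$ and let $e_0=c_0/(1-a_0)$. (i) If there exist $p_i\in(0,1)$, $0\le i\le N-1$, with $\sum_ip_i=1$, such that for every $i\in\Sigma_N$ $$a_i=\frac{p_i+e_0\sum_{j=0}^ip_j}{\left(1-\sum_{j=0}^{i-1}p_j\right)e_0+1},\qquad b_i=\frac{\sum_{j=0}^{i-1}p_j}{\left(1-\sum_{j=0}^{i-1}p_j\right)e_0+1},$$ $$c_i=\frac{e_0\left(\left(1-\sum_{j=0}^ip_j\right)e_0+1-p_i\right)}{\left(1-\sum_{j=0}^{i-1}p_j\right)e_0+1},$$ then $\mu_\varphi$ is absolutely continuous with respect to the $(p_0,\dots,p_{N-1})$-self-similar measure $\mu_{(p_0,\dots,p_{N-1})}$. (ii) If no such $(p_i)_i$ exists, then $\mu_\varphi$ is singular with respect to every $(p_0,\dots,p_{N-1})$-self-similar measure with $p_i\in(0,1)$, $i\in\Sigma_N$.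
   Context: Let $N\ge2$, $\Sigma_N=\{0,\dots,N-1\}$. For a real matrix $A=\begin{pmatrix}a&b\\c&d\end{pmatrix}$ put $\Phi(A;z)=\frac{az+b}{cz+d}$. Let $A_i=\begin{pmatrix}a_i&b_i\\c_i&d_i\end{pmatrix}$, $i\in\Sigma_N$, be real matrices, normalized so that $d_i=1$, satisfying: (A1) $\Phi(A_0;0)=0$, $\Phi(A_{N-1};1)=1$, and $\Phi(A_{i-1};1)=\Phi(A_i;0)$ for $i=1,\dots,N-1$; (A2) $a_id_i-b_ic_i>0$ for all $i$; (A3) $(a_id_i-b_ic_i)^{1/2}\le\min\{d_i,c_i+d_i\}$ for all $i$. Let $g_i(x)=\Phi(A_i;x)$ for $x\in[0,1]$. (These conditions guarantee existence and uniqueness of the continuous solution $\varphi:[0,1]\to[0,1]$.) For $p_i\in(0,1)$ with $\sum_ip_i=1$, the $(p_0,\dots,p_{N-1})$-self-similar measure $\mu_{(p_0,\dots,p_{N-1})}$ is the unique Borel probability measure $\mu$ on $[0,1]$ with $\mu=\sum_ip_i\,\mu\circ S_i^{-1}$, where $S_i(z)=(z+i)/N$. Empty sums are $0$. *)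

(* Defs.v *)
From HB Require Import structures.
From mathcomp Require Import all_boot all_order all_algebra.
From mathcomp Require Import all_classical all_reals all_analysis.
Set Implicit Arguments.
Unset Strict Implicit.
Unset Printing Implicit Defensive.
Import Order.TTheory GRing.Theory Num.Theory.
Import numFieldNormedType.Exports.
Local Open Scope classical_set_scope.
Local Open Scope ring_scope.

(* The digits 0 and N - 1 of Sigma_N = 'I_N. *)
Definition digit_first (N : nat) (hN : (2 <= N)%N) : 'I_N := Ordinal (ltnW hN).
Definition digit_last (N : nat) (hN : (2 <= N)%N) : 'I_N :=
  rev_ord (digit_first hN).

Definition moebius (R : realType) (A : 'M[R]_2) (z : R) : R :=
  (A 0 0 * z + A 0 1) / (A 1 0 * z + A 1 1).

Definition det2 (R : realType) (A : 'M[R]_2) : R :=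
  A 0 0 * A 1 1 - A 0 1 * A 1 0.

Record admissible (R : realType) (N : nat) (hN : (2 <= N)%N)
    (A : 'I_N -> 'M[R]_2) : Prop := Admissible {
  adm_normalized : forall i, A i 1 1 = 1;
  adm_at0 : moebius (A (digit_first hN)) 0 = 0;
  adm_at1 : moebius (A (digit_last hN)) 1 = 1;
  adm_glue : forall i j : 'I_N, j = i.+1 :> nat ->
    moebius (A i) 1 = moebius (A j) 0;
  adm_det_gt0 : forall i, 0 < det2 (A i);
  adm_det_le : forall i,
    Num.sqrt (det2 (A i)) <= Num.min (A i 1 1) (A i 1 0 + A i 1 1) }.

(* [phi] is total on R, but only its restriction to [0, 1] is constrained. *)
Record continuous_solution (R : realType) (N : nat) (A : 'I_N -> 'M[R]_2)
    (phi : R -> R) : Prop := ContinuousSolution {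
  sol_continuous : {within `[0, 1], continuous phi};
  sol_unit : forall x, 0 <= x <= 1 -> 0 <= phi x <= 1;
  sol_eq : forall (i : 'I_N) (x : R), i%:R / N%:R <= x <= i.+1%:R / N%:R ->
    phi x = moebius (A i) (phi (N%:R * x - i%:R)) }.

(* Borel probability measures on [0, 1] are represented as Borel probability
   measures on R that give full mass to [0, 1]. *)
Definition on_unit_interval (R : realType)
    (mu : probability (measurableTypeR R) R) : Prop :=
  mu `[0, 1]%classic = 1%E.

Definition has_distribution_function (R : realType)
    (mu : probability (measurableTypeR R) R) (phi : R -> R) : Prop :=
  on_unit_interval mu /\
  forall x, 0 <= x <= 1 -> mu `]-oo, x]%classic = (phi x)%:E.

Definition positive_weights (R : realType) (N : nat) (p : 'I_N -> R) : Prop :=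
  (forall i, 0 < p i < 1) /\ \sum_(i < N) p i = 1.

Definition similitude (R : realType) (N : nat) (i : 'I_N)
    (z : measurableTypeR R) : measurableTypeR R :=
  (z + i%:R) / N%:R.

Definition self_similar (R : realType) (N : nat) (p : 'I_N -> R)
    (mu : probability (measurableTypeR R) R) : Prop :=
  on_unit_interval mu /\
  forall B : set (measurableTypeR R), measurable B ->
    mu B = (\sum_(i < N) (p i)%:E * pushforward mu (similitude i) B)%E.

Definition mutually_singular (R : realType)
    (mu nu : probability (measurableTypeR R) R) : Prop :=
  exists B : set (measurableTypeR R),
    [/\ measurable B, mu B = 0%E & nu (~` B) = 0%E].

(* \sum_(j < N | j < i) p j is p_0 + ... + p_(i-1), and
   \sum_(j < N | j <= i) p j is p_0 + ... + p_i. *)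
Definition coefficient_identities (R : realType) (N : nat)
    (A : 'I_N -> 'M[R]_2) (e0 : R) (p : 'I_N -> R) : Prop :=
  forall i : 'I_N,
    let sum_lt := \sum_(j < N | (j < i)%N) p j in
    let sum_le := \sum_(j < N | (j <= i)%N) p j in
    [/\ A i 0 0 = (p i + e0 * sum_le) / ((1 - sum_lt) * e0 + 1),
        A i 0 1 = sum_lt / ((1 - sum_lt) * e0 + 1) &
        A i 1 0 = e0 * ((1 - sum_le) * e0 + 1 - p i)
                  / ((1 - sum_lt) * e0 + 1)].

(* Main.v *)
(* For t > -1 put bend t y = (1 + t) y / (1 + t y).  Then bend t (g_i y) is
   affine in bend (next_param (A i) t) y, with slope cell_mass (A i) t, so that
   the mass given by mu_phi to an N-adic interval is the product of the slopes
   met along its digits while t moves from 0 under the maps next_param (A i).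

   If the coefficient identities hold, then e0 is fixed by all of these maps and
   the slopes at e0 are the p_i; hence the distribution function of the
   self-similar measure is bend e0 o phi, and since bend e0 is bi-Lipschitz,
   mu_phi is dominated by a multiple of that measure.

   Conversely, let q be weights and let F_n(t) be the Hellinger affinity of the
   two measures on N-adic intervals of length N^-n, started at t.  The first
   slope is strictly increasing in t, so F_1(t) is bounded away from 1 unless t
   is near the unique point x with first slope q_0, and F_2(x) = 1 would force x
   to be fixed by all parameter maps with slopes q_i, i.e. x = e0 and the
   identities would hold.  So F_2 <= theta < 1 uniformly, F_2n(0) <= theta^n,
   and the measures are singular. *)

Require Import Defs.
From HB Require Import structures.
From mathcomp Require Import all_boot all_order all_algebra.
From mathcomp Require Import all_classical all_reals all_analysis.
From mathcomp Require Import ring lra.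
Set Implicit Arguments.
Unset Strict Implicit.
Unset Printing Implicit Defensive.
Import Order.TTheory GRing.Theory Num.Theory.
Import numFieldNormedType.Exports.
Local Open Scope classical_set_scope.
Local Open Scope ring_scope.

(* For [t > -1], the general increasing Moebius map fixing 0 and 1. *)
Definition bend (R : realType) (t y : R) : R := (1 + t) * y / (1 + t * y).

(** The pole of [bend s] is [-1/s]. When [A 1 1 = 1], the parameter returned here is the one whose
    pole is that of [bend t] composed with [moebius A]. *)
Definition next_param (R : realType) (A : 'M[R]_2) (t : R) : R :=
  (A 0 0 * t + A 1 0) / (1 + t * A 0 1).

(* The length of the image of [0, 1] under [bend t \o moebius A]. *)
Definition cell_mass (R : realType) (A : 'M[R]_2) (t : R) : R :=
  (1 + t) * det2 A /
    ((1 + t * A 0 1) * (A 1 0 + 1 + t * (A 0 0 + A 0 1))).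

(** * Moebius maps of the unit interval fixing its endpoints *)

Section Bend.
Context {R : realType}.
Implicit Types (t y z : R) (A : 'M[R]_2).

(** [1 + t * y] is the convex combination of [1] and [1 + t] with weights [1 - y] and [y]. *)
Lemma bend_den_gt0 t y : -1 < t -> 0 <= y <= 1 -> 0 < 1 + t * y.
Proof.
move=> t1 /andP[y0 y1]; have [t0|t0] := leP 0 t.
  by have := mulr_ge0 t0 y0; lra.
have h : t <= t * y by nra.
by lra.
Qed.

Lemma bend0 t : bend t 0 = 0.
Proof. by rewrite /bend mulr0 mul0r. Qed.

Lemma bend1 t : -1 < t -> bend t 1 = 1.
Proof. by move=> t1; rewrite /bend !mulr1 divff// gt_eqF//; lra. Qed.

Lemma bend_param0 y : bend 0 y = y.
Proof. by rewrite /bend mul0r !addr0 mul1r divr1. Qed.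

Lemma bendB t y z : -1 < t -> 0 <= y <= 1 -> 0 <= z <= 1 ->
  bend t z - bend t y = (1 + t) * (z - y) / ((1 + t * y) * (1 + t * z)).
Proof.
move=> t1 y01 z01; have hy := bend_den_gt0 t1 y01; have hz := bend_den_gt0 t1 z01.
by rewrite /bend; field; rewrite !gt_eqF.
Qed.

(** In the quotient of [bendB] both denominators are at most [1 + |t|], which gives the constant.
    This lower Lipschitz bound later turns a comparison of distribution functions into domination of
    measures. *)
Lemma bend_expansive t : -1 < t -> exists2 C : R, 0 < C & forall y z,
  0 <= y <= 1 -> 0 <= z <= 1 -> y <= z -> z - y <= C * (bend t z - bend t y).
Proof.
move=> t1; have t0 : 0 < 1 + t by lra.
exists ((1 + `|t|) ^+ 2 / (1 + t)).
  by rewrite divr_gt0// exprn_gt0// ltr_pwDl.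
move=> y z y01 z01 yz; rewrite bendB//.
have hy := bend_den_gt0 t1 y01; have hz := bend_den_gt0 t1 z01.
have le x : 0 <= x <= 1 -> 1 + t * x <= 1 + `|t|.
  move=> /andP[x0 x1]; rewrite lerD2l (le_trans (ler_norm _))// normrM.
  by rewrite (ger0_norm x0) ler_piMr.
have hD := mulr_gt0 hy hz.
have -> : (1 + `|t|) ^+ 2 / (1 + t) *
    ((1 + t) * (z - y) / ((1 + t * y) * (1 + t * z))) =
    (z - y) * ((1 + `|t|) ^+ 2 / ((1 + t * y) * (1 + t * z))).
  by field; rewrite !gt_eqF.
rewrite ler_peMr ?subr_ge0// ler_pdivlMr// mul1r expr2.
by rewrite ler_pM// ?le// ltW.
Qed.

Lemma bend_param_mono y : 0 < y < 1 -> forall s t,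
  -1 < s -> s < t -> bend s y < bend t y.
Proof.
move=> /andP[y0 y1] s t s1 st.
have t1 : -1 < t by exact: lt_trans st.
have hs := @bend_den_gt0 s y s1 ltac:(lra).
have ht := @bend_den_gt0 t y t1 ltac:(lra).
rewrite /bend -subr_gt0.
have -> : (1 + t) * y / (1 + t * y) - (1 + s) * y / (1 + s * y) =
  y * (1 - y) * (t - s) / ((1 + t * y) * (1 + s * y)).
  by field; rewrite !gt_eqF.
by rewrite divr_gt0 ?mulr_gt0// subr_gt0.
Qed.

(** * Conjugating a single Moebius map by [bend] *)

Section Cell.
Variable A : 'M[R]_2.
Hypotheses (A11 : A 1 1 = 1) (detA : 0 < det2 A).
Hypotheses (A01 : 0 <= A 0 1 < 1) (A10 : 0 < A 1 0 + 1).
Hypothesis im1 : moebius A 1 <= 1.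

Lemma moebius0 : moebius A 0 = A 0 1.
Proof. by rewrite /moebius !mulr0 !add0r A11 divr1. Qed.

Let le_im1 : A 0 0 + A 0 1 <= A 1 0 + 1.
Proof. by move: im1; rewrite /moebius !mulr1 A11 ler_pdivrMr// mul1r. Qed.

Lemma moebius_den_gt0 y : 0 <= y <= 1 -> 0 < A 1 0 * y + 1.
Proof.
move=> /andP[y0 y1]; have h := mulr_ge0 y0 (ltW A10).
have [y1'|y1'] := ltP y 1; first by lra.
have -> : y = 1 by lra.
by move: A10; lra.
Qed.

Lemma moebius_unit y : 0 <= y <= 1 -> 0 <= moebius A y <= 1.
Proof.
move=> y01; have h := moebius_den_gt0 y01; move: (y01) => /andP[y0 y1].
have d := detA; rewrite /det2 A11 mulr1 in d.
rewrite /moebius A11; apply/andP; split.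
  apply: divr_ge0; last exact: ltW.
  (* [A 0 0] may be negative, so the numerator is regrouped as the determinant times [y] plus
     [A 0 1] times the denominator. *)
  have -> : A 0 0 * y + A 0 1 =
    (A 0 0 - A 0 1 * A 1 0) * y + A 0 1 * (A 1 0 * y + 1) by ring.
  by rewrite addr_ge0// mulr_ge0// ?(ltW d) ?(ltW h)//; case/andP: A01.
rewrite ler_pdivrMr// mul1r.
have l1 : A 0 1 <= 1 by case/andP: A01 => _ /ltW.
have l2 := le_im1.
have : (1 - y) * (1 - A 0 1) + y * (A 1 0 + 1 - A 0 0 - A 0 1) >= 0.
  by rewrite addr_ge0 ?mulr_ge0//; lra.
by lra.
Qed.

Lemma next_param_den_gt0 t : -1 < t -> 0 < 1 + t * A 0 1.
Proof. by move=> t1; apply: bend_den_gt0 => //; move: A01; lra. Qed.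

Lemma cell_mass_den_gt0 t : -1 < t -> 0 < A 1 0 + 1 + t * (A 0 0 + A 0 1).
Proof.
move=> t1; have d := detA; rewrite /det2 A11 mulr1 in d.
have h : 0 < A 0 0 + A 0 1.
  have e : A 0 0 + A 0 1 = (A 0 0 - A 0 1 * A 1 0) + A 0 1 * (A 1 0 + 1) by ring.
  by rewrite e ltr_pwDl// mulr_ge0 ?(ltW A10)//; case/andP: A01.
(* The expression is this product plus [A 1 0 + 1 - (A 0 0 + A 0 1)], which is nonnegative because
   the image of 1 is at most 1. *)
have : 0 < (1 + t) * (A 0 0 + A 0 1) by rewrite mulr_gt0//; lra.
by move: le_im1; lra.
Qed.

(** [1 + next_param A t] is the quotient of the two positive factors in the denominator of
    [cell_mass]. *)
Lemma next_param_gtN1 t : -1 < t -> -1 < next_param A t.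
Proof.
move=> t1; have h := next_param_den_gt0 t1; have k := cell_mass_den_gt0 t1.
by rewrite /next_param ltr_pdivlMr//; lra.
Qed.

Lemma cell_mass_gt0 t : -1 < t -> 0 < cell_mass A t.
Proof.
move=> t1; have h := next_param_den_gt0 t1; have k := cell_mass_den_gt0 t1.
by rewrite divr_gt0 ?mulr_gt0//; lra.
Qed.

(** Both sides are Moebius functions of [y] with the same pole and the value 0 at [y = 0], so they
    are proportional; the value at [y = 1] fixes the factor. *)
Lemma bend_moebius t y : -1 < t -> 0 <= y <= 1 ->
  bend t (moebius A y) - bend t (A 0 1) =
  cell_mass A t * bend (next_param A t) y.
Proof.
move=> t1 y01; have h := next_param_den_gt0 t1; have k := cell_mass_den_gt0 t1.
have l := bend_den_gt0 (next_param_gtN1 t1) y01.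
have m := bend_den_gt0 t1 (moebius_unit y01).
have n := moebius_den_gt0 y01.
have -> : bend (next_param A t) y =
    (1 + next_param A t) * y / (1 + next_param A t * y) by [].
(* [l'] and [m'] are the denominators that remain once the nested quotients are cleared; each is a
   product of two positive denominators. *)
have l' : 1 + t * A 0 1 + (A 0 0 * t + A 1 0) * y != 0.
  rewrite gt_eqF// (_ : _ + _ = (1 + t * A 0 1) * (1 + next_param A t * y)).
    by rewrite mulr_gt0.
  by rewrite /next_param; field; rewrite gt_eqF.
have m' : A 1 0 * y + 1 + t * (A 0 0 * y + A 0 1) != 0.
  rewrite gt_eqF// (_ : _ + _ = (A 1 0 * y + 1) * (1 + t * moebius A y)).
    by rewrite mulr_gt0.
  by rewrite /moebius A11; field; rewrite gt_eqF.
rewrite bendB ?moebius_unit//; last by move: A01; lra.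
rewrite /moebius /next_param /cell_mass /det2 A11; field.
rewrite ?l' ?m' !gt_eqF//.
Qed.

Lemma cell_massE t : -1 < t ->
  cell_mass A t = bend t (moebius A 1) - bend t (A 0 1).
Proof.
move=> t1; rewrite bend_moebius ?ler01 ?lexx// bend1 ?mulr1//.
exact: next_param_gtN1.
Qed.

End Cell.
End Bend.

Lemma big_ord_ltn_recr (R : nmodType) (N : nat) (F : 'I_N -> R) (i : 'I_N) :
  \sum_(j < N | (j < i.+1)%N) F j = \sum_(j < N | (j < i)%N) F j + F i.
Proof.
rewrite (bigD1 i)//= addrC; congr (_ + _); apply: eq_bigl => j.
by rewrite ltnS leq_eqVlt -val_eqE; case: ltngtP.
Qed.

(** * Breakpoints and slopes of an admissible system *)

Section Ifs.
Context {R : realType} {N : nat}.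
Variables (hN : (2 <= N)%N) (A : 'I_N -> 'M[R]_2).

(** Indexed by naturals so that sums telescope and inductions run over [k]; the default value 1
    serves as the right endpoint [k = N]. *)
Definition breakpoint (k : nat) : R :=
  if insub k is Some i then A i 0 1 else 1.

Lemma breakpoint_ord (i : 'I_N) : breakpoint i = A i 0 1.
Proof. by rewrite /breakpoint valK. Qed.

Lemma breakpointN : breakpoint N = 1.
Proof. by rewrite /breakpoint insubF ?ltnn. Qed.

Hypothesis hA : admissible hN A.

(** The square root in (A3) is positive by (A2) and bounds this quantity from below. *)
Lemma adm_A10 i : 0 < A i 1 0 + 1.
Proof.
have := adm_det_le hA i; rewrite (adm_normalized hA i) le_min => /andP[_].
by apply: lt_le_trans; rewrite sqrtr_gt0; exact: adm_det_gt0 hA i.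
Qed.

Lemma moebius0_adm i : moebius (A i) 0 = A i 0 1.
Proof. exact/moebius0/(adm_normalized hA). Qed.

Lemma breakpoint0 : breakpoint 0 = 0.
Proof.
rewrite -(adm_at0 hA) moebius0_adm -(breakpoint_ord (digit_first hN)).
by congr breakpoint.
Qed.

Lemma breakpointS (i : 'I_N) : breakpoint i.+1 = moebius (A i) 1.
Proof.
have [iN|] := ltnP i.+1 N.
  by rewrite (adm_glue hA (j := Ordinal iN))// moebius0_adm -breakpoint_ord.
move=> Ni; have iN : i.+1 = N by apply/eqP; rewrite eqn_leq ltn_ord.
rewrite iN breakpointN -[LHS](adm_at1 hA); congr (moebius (A _) _).
by apply: val_inj; rewrite /= subn1 -(congr1 predn iN).
Qed.

Lemma ltr_breakpointS (i : 'I_N) : breakpoint i < breakpoint i.+1.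
Proof.
have d := adm_det_gt0 hA i; have h := adm_A10 i.
rewrite /det2 (adm_normalized hA) mulr1 in d.
rewrite breakpointS breakpoint_ord /moebius (adm_normalized hA) !mulr1.
by rewrite ltr_pdivlMr//; lra.
Qed.

Lemma breakpoint_ge0 k : (k <= N)%N -> 0 <= breakpoint k.
Proof.
elim: k => [|k IH kN]; first by rewrite breakpoint0.
by rewrite (le_trans (IH (ltnW kN)))// ltW// (ltr_breakpointS (Ordinal kN)).
Qed.

Lemma breakpoint_le1 k : (k <= N)%N -> breakpoint k <= 1.
Proof.
(* Downward induction from [N], where the breakpoint is 1. *)
move=> kN; have [m] : exists m, m = (N - k)%N by exists (N - k)%N.
elim: m k kN => [k kN /esym/eqP|m IH k kN mE].
  rewrite subn_eq0 => Nk; suff -> : k = N by rewrite breakpointN.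
  by apply/eqP; rewrite eqn_leq kN.
have kN' : (k < N)%N by rewrite -subn_gt0 -mE.
rewrite (le_trans (ltW (ltr_breakpointS (Ordinal kN'))))//.
by apply: IH => //=; rewrite subnS -mE.
Qed.

Lemma adm_A01 i : 0 <= A i 0 1 < 1.
Proof.
rewrite -breakpoint_ord breakpoint_ge0 1?ltnW//=.
by rewrite (lt_le_trans (ltr_breakpointS i))// breakpoint_le1.
Qed.

Lemma adm_im1 i : moebius (A i) 1 <= 1.
Proof. by rewrite -breakpointS breakpoint_le1. Qed.

Lemma adm_cell_mass_gt0 i t : -1 < t -> 0 < cell_mass (A i) t.
Proof.
exact: cell_mass_gt0 (adm_normalized hA i) (adm_det_gt0 hA i) (adm_A01 i)
  (adm_A10 i) (adm_im1 i) t.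
Qed.

Lemma adm_next_param_gtN1 i t : -1 < t -> -1 < next_param (A i) t.
Proof.
exact: next_param_gtN1 (adm_normalized hA i) (adm_det_gt0 hA i) (adm_A01 i)
  (adm_A10 i) (adm_im1 i) t.
Qed.

Lemma adm_bend_moebius i t y : -1 < t -> 0 <= y <= 1 ->
  bend t (moebius (A i) y) - bend t (A i 0 1) =
  cell_mass (A i) t * bend (next_param (A i) t) y.
Proof.
exact: bend_moebius (adm_normalized hA i) (adm_det_gt0 hA i) (adm_A01 i)
  (adm_A10 i) (adm_im1 i) t y.
Qed.

Lemma adm_cell_massE i t : -1 < t ->
  cell_mass (A i) t = bend t (breakpoint i.+1) - bend t (breakpoint i).
Proof.
move=> t1; rewrite breakpointS breakpoint_ord.
exact: (cell_massE (adm_normalized hA i) (adm_det_gt0 hA i) (adm_A01 i)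
  (adm_A10 i) (adm_im1 i)).
Qed.

(** The slopes are the increments of [bend t] along the breakpoints, so the sum telescopes. Thus
    every parameter yields a probability vector. *)
Lemma sum_cell_mass t : -1 < t -> \sum_(i < N) cell_mass (A i) t = 1.
Proof.
move=> t1.
rewrite (eq_bigr (fun i : 'I_N =>
  bend t (breakpoint i.+1) - bend t (breakpoint i))).
  rewrite -(big_mkord xpredT
    (fun k => bend t (breakpoint k.+1) - bend t (breakpoint k))).
  by rewrite telescope_sumr// breakpointN breakpoint0 bend1// bend0 subr0.
by move=> i _; rewrite adm_cell_massE.
Qed.

Local Notation i0 := (digit_first hN).

(** The first map fixes 0, so its entry [A i0 0 1] vanishes and the parameter map is affine. If
    [A i0 0 0 < 1], its only fixed point is [A i0 1 0 / (1 - A i0 0 0)], the [e0] of the theorem. *)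
Lemma next_param_first t : next_param (A i0) t = A i0 0 0 * t + A i0 1 0.
Proof.
have := breakpoint_ord i0; rewrite (_ : breakpoint i0 = 0); last exact: breakpoint0.
by rewrite /next_param => <-; rewrite mulr0 addr0 divr1.
Qed.

Lemma breakpoint1_gt0_lt1 : 0 < breakpoint 1 < 1.
Proof.
apply/andP; split; first by rewrite -breakpoint0 (ltr_breakpointS i0).
have h := adm_A01 (Ordinal hN).
by rewrite (breakpoint_ord (Ordinal hN)); case/andP: h.
Qed.

Lemma cell_mass_first t : -1 < t -> cell_mass (A i0) t = bend t (breakpoint 1).
Proof. by move=> t1; rewrite adm_cell_massE// breakpoint0 bend0 subr0. Qed.

(** There are at least two digits, so the first map sends 1 strictly below 1; clearing the
    denominator gives [A i0 0 0 < A i0 1 0 + 1]. *)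
Lemma first_param_gtN1 : A i0 0 0 < 1 -> -1 < A i0 1 0 / (1 - A i0 0 0).
Proof.
move=> a1; have := breakpoint1_gt0_lt1; rewrite (breakpointS i0).
rewrite /moebius (adm_normalized hA) !mulr1 => /andP[_].
have h := adm_A10 i0; have := adm_A01 i0.
rewrite ltr_pdivrMr// ltr_pdivlMr ?subr_gt0// => /andP[b0 _].
lra.
Qed.

End Ifs.

(** * Quantitative bound on the Hellinger affinity *)

Section Hellinger.
Context {R : realType} {N : nat}.
Implicit Types p q : 'I_N -> R.

(** One minus the affinity is half the sum of the squares [(x j - y j) ^+ 2] of differences of
    square roots. Only the term [i] is kept, and [x i + y i <= 2] gives
    [(p i - q i) ^+ 2 <= 4 * (x i - y i) ^+ 2]; hence the 8. *)
Lemma sum_sqrtM_le p q i : (forall j, 0 < p j) -> (forall j, 0 < q j) ->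
  \sum_(j < N) p j = 1 -> \sum_(j < N) q j = 1 ->
  \sum_(j < N) Num.sqrt (p j * q j) <= 1 - (p i - q i) ^+ 2 / 8.
Proof.
move=> p0 q0 sp sq.
have le1 (r : 'I_N -> R) : (forall j, 0 < r j) -> \sum_(j < N) r j = 1 ->
      Num.sqrt (r i) <= 1.
  move=> r0 sr; rewrite -[leRHS]sqrtr1 ler_sqrt// -sr (bigD1 i)//= lerDl.
  by apply: sumr_ge0 => j _; exact: ltW.
pose x j := Num.sqrt (p j); pose y j := Num.sqrt (q j).
have pE j : p j = x j ^+ 2 by rewrite sqr_sqrtr// ltW.
have qE j : q j = y j ^+ 2 by rewrite sqr_sqrtr// ltW.
have -> : \sum_(j < N) Num.sqrt (p j * q j) =
    1 - (\sum_(j < N) (x j - y j) ^+ 2) / 2.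
  rewrite -[X in X - _](divff (x := 2)) ?pnatr_eq0// -mulrBl.
  rewrite [X in X - _](_ : 2 = \sum_(j < N) p j + \sum_(j < N) q j); last by lra.
  rewrite -big_split/= -sumrB mulr_suml; apply: eq_bigr => j _.
  by rewrite sqrtrM ?(ltW (p0 j))// -/(x j) -/(y j) pE qE; field.
have le_i : (x i - y i) ^+ 2 <= \sum_(j < N) (x j - y j) ^+ 2.
  by rewrite (bigD1 i)//= lerDl; apply: sumr_ge0 => j _; exact: sqr_ge0.
have x1 : x i <= 1 := le1 p p0 sp; have y1 : y i <= 1 := le1 q q0 sq.
have x0 : 0 <= x i := sqrtr_ge0 _; have y0 : 0 <= y i := sqrtr_ge0 _.
have : (p i - q i) ^+ 2 <= 4 * (x i - y i) ^+ 2.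
  rewrite pE qE subr_sqr exprMn mulrC ler_wpM2r ?sqr_ge0//.
  rewrite (_ : 4 = 2 ^+ 2); last by ring.
  by rewrite lerXn2r ?nnegrE//; lra.
lra.
Qed.

End Hellinger.

(** * Masses, weights and affinities along digit words *)

Section Words.
Context {R : realType} {N : nat}.
Variables (A : 'I_N -> 'M[R]_2) (q : 'I_N -> R).

Fixpoint words (n : nat) : seq (seq 'I_N) :=
  if n is m.+1 then [seq i :: w | i <- enum 'I_N, w <- words m] else [:: [::]].

Fixpoint word_mass (t : R) (w : seq 'I_N) : R :=
  if w is i :: w' then cell_mass (A i) t * word_mass (next_param (A i) t) w'
  else 1.

Definition word_weight (w : seq 'I_N) : R := \prod_(i <- w) q i.

(** The quantity F_n(t), defined by recursion on the first digit so that the starting parameter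
    varies; [sum_words_sqrt] identifies it with the sum over words. *)
Fixpoint affinity (n : nat) (t : R) : R :=
  if n is m.+1 then
    \sum_(i < N) Num.sqrt (cell_mass (A i) t * q i) *
      affinity m (next_param (A i) t)
  else 1.

Lemma affinity_ge0 n t : 0 <= affinity n t.
Proof.
elim: n t => [t|n IH t] /=; first exact: ler01.
by apply: sumr_ge0 => i _; rewrite mulr_ge0 ?sqrtr_ge0.
Qed.

Lemma affinity1E t :
  affinity 1 t = \sum_(i < N) Num.sqrt (cell_mass (A i) t * q i).
Proof. by apply: eq_bigr => i _; rewrite mulr1. Qed.

Hypotheses (hN : (2 <= N)%N) (hA : admissible hN A) (hq : positive_weights q).

Let q0 i : 0 < q i. Proof. by case: hq => /(_ i)/andP[]. Qed.

Lemma sum_words_sqrt n t : -1 < t ->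
  \sum_(w <- words n) Num.sqrt (word_mass t w * word_weight w) = affinity n t.
Proof.
elim: n t => [|n IH] t t1 /=.
  by rewrite big_seq1 /word_weight big_nil mulr1 sqrtr1.
rewrite big_allpairs_dep big_enum/=; apply: eq_bigr => i _.
rewrite -IH ?(adm_next_param_gtN1 hA)// mulr_sumr; apply: eq_bigr => w _.
rewrite /word_weight big_cons mulrACA sqrtrM// mulr_ge0// ltW//.
exact: adm_cell_mass_gt0 hA i _ t1.
Qed.

Lemma affinity1_le i t : -1 < t ->
  affinity 1 t <= 1 - (cell_mass (A i) t - q i) ^+ 2 / 8.
Proof.
move=> t1; rewrite affinity1E.
apply: (@sum_sqrtM_le _ _ (fun j => cell_mass (A j) t)) => //.
- by move=> j; exact: adm_cell_mass_gt0 hA j _ t1.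
- exact: sum_cell_mass hA _ t1.
- by case: hq.
Qed.

Lemma affinity1_le1 t : -1 < t -> affinity 1 t <= 1.
Proof.
move=> t1; apply: (le_trans (affinity1_le (digit_first hN) t1)).
by rewrite gerBl divr_ge0// sqr_ge0.
Qed.

(** Digits are read two at a time: [theta] bounds the two-digit affinity at every admissible
    parameter, in particular at each one reached so far, so the bounds multiply. *)
Lemma affinity_double_le theta n t :
  (forall s, -1 < s -> affinity 2 s <= theta) -> -1 < t ->
  affinity n.*2 t <= theta ^+ n.
Proof.
move=> h2; have th0 : 0 <= theta.
  by apply: le_trans (h2 0 _); rewrite ?affinity_ge0// ltrN10.
elim: n t => [|n IH] t t1; first by rewrite expr0.
rewrite doubleS exprSr [leRHS]mulrC.
apply: (@le_trans _ _ (affinity 2 t * theta ^+ n)); last first.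
  by rewrite ler_wpM2r ?exprn_ge0 ?h2.
rewrite /= mulr_suml; apply: ler_sum => i _; rewrite -[leRHS]mulrA.
rewrite ler_wpM2l ?sqrtr_ge0// mulr_suml; apply: ler_sum => j _.
by rewrite mulr1 ler_wpM2l ?sqrtr_ge0// IH// !(adm_next_param_gtN1 hA).
Qed.

Lemma affinity2_le1 t : -1 < t -> affinity 2 t <= affinity 1 t.
Proof.
move=> t1; rewrite affinity1E; apply: ler_sum => i _.
by rewrite ler_piMr ?sqrtr_ge0// affinity1_le1// (adm_next_param_gtN1 hA).
Qed.

End Words.

(** * Coefficient identities as a common fixed parameter *)

Section Identities.
Context {R : realType} {N : nat}.
Variables (hN : (2 <= N)%N) (A : 'I_N -> 'M[R]_2).
Hypothesis hA : admissible hN A.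

Lemma partial_weight_bounds (p : 'I_N -> R) (i : 'I_N) : positive_weights p ->
  0 <= \sum_(j < N | (j < i)%N) p j /\ \sum_(j < N | (j < i)%N) p j + p i <= 1.
Proof.
move=> [p01 sp]; have p0 j : 0 <= p j by case/andP: (p01 j) => /ltW.
split; first by apply: sumr_ge0 => j _.
rewrite -big_ord_ltn_recr -sp [leRHS](bigID (fun j : 'I_N => (j < i.+1)%N))/=.
by rewrite lerDl sumr_ge0.
Qed.

(** The identities say that [bend e] conjugates the [i]-th map to the affine map with slope [p i]
    and value [p_0 + ... + p_(i-1)] at 0. *)
Lemma fixed_param_of_identities (e : R) (p : 'I_N -> R) : -1 < e ->
  positive_weights p -> coefficient_identities A e p ->
  forall i, cell_mass (A i) e = p i /\ next_param (A i) e = e.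
Proof.
move=> e1 hp hid i; have [s0 s1] := partial_weight_bounds i hp.
have [] := hid i.
have -> : \sum_(j < N | (j <= i)%N) p j = \sum_(j < N | (j < i)%N) p j + p i.
  by rewrite -big_ord_ltn_recr.
move: s0 s1; set s := \sum_(j < N | _) p j => s0 s1 a00 a01 a10.
have pi0 : 0 < p i by case: hp => /(_ i)/andP[].
have D0 : 0 < (1 - s) * e + 1.
  by rewrite mulrC addrC; apply: bend_den_gt0 => //; lra.
have a11 := adm_normalized hA i.
have n1 := next_param_den_gt0 (adm_A01 hA i) e1.
have n2 := cell_mass_den_gt0 a11 (adm_det_gt0 hA i) (adm_A01 hA i)
  (adm_A10 hA i) (adm_im1 hA i) e1.
have e10 : 1 + e != 0 by rewrite gt_eqF//; lra.
(* With [K = (1 + e) / ((1 - s) * e + 1)], the denominator of [cell_mass] has factors [K] and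
   [(1 + e) * K] and the determinant is [p i * K ^+ 2], so the slope reduces to [p i]. *)
have E1 : 1 + e * A i 0 1 = (1 + e) / ((1 - s) * e + 1).
  by rewrite a01; field; rewrite gt_eqF.
have E2 : next_param (A i) e = e.
  rewrite /next_param E1 a00 a10; field.
  by rewrite ?e10 ?gt_eqF.
have E3 : det2 (A i) = p i * ((1 + e) / ((1 - s) * e + 1)) ^+ 2.
  by rewrite /det2 a11 a00 a10 a01; field; rewrite gt_eqF.
have E4 : A i 1 0 + 1 + e * (A i 0 0 + A i 0 1) =
    (1 + e) * ((1 + e) / ((1 - s) * e + 1)).
  by rewrite a00 a10 a01; field; rewrite gt_eqF.
split=> //; rewrite /cell_mass E1 E3 E4; field.
by rewrite ?e10 gt_eqF.
Qed.

Lemma bend_breakpoint (e : R) (q : 'I_N -> R) k : -1 < e ->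
  (forall i, cell_mass (A i) e = q i) -> (k <= N)%N ->
  bend e (breakpoint A k) = \sum_(j < N | (j < k)%N) q j.
Proof.
move=> e1 hm; elim: k => [_|k IH kN].
  by rewrite (breakpoint0 hA) bend0 big_pred0.
have /= h := adm_cell_massE hA (Ordinal kN) e1.
rewrite -[LHS](subrK (bend e (breakpoint A k))) -h hm IH ?(ltnW kN)//.
by rewrite (@big_ord_ltn_recr _ _ q (Ordinal kN)) addrC.
Qed.

(** The partial sums of [q] are the images of the breakpoints under [bend e]; inverting [bend e]
    recovers the breakpoints, hence [A i 0 1]. The other two entries solve the linear system formed
    by the fixed-parameter equation [ac] and the right-endpoint equation [ab]. *)
Lemma identities_of_fixed_param (e : R) (q : 'I_N -> R) : -1 < e ->
  positive_weights q ->
  (forall i, cell_mass (A i) e = q i) -> (forall i, next_param (A i) e = e) ->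
  coefficient_identities A e q.
Proof.
move=> e1 hq hm hf.
pose s k := \sum_(j < N | (j < k)%N) q j.
have bs k : (k <= N)%N -> bend e (breakpoint A k) = s k.
  exact: bend_breakpoint.
have den k : (k <= N)%N -> 0 < 1 + e * breakpoint A k.
  move=> kN; apply: bend_den_gt0 => //.
  by rewrite (breakpoint_ge0 hA kN) (breakpoint_le1 hA kN).
have e10 : 1 + e != 0 by rewrite gt_eqF//; lra.
have bp k : (k <= N)%N ->
    (1 - s k) * e + 1 = (1 + e) / (1 + e * breakpoint A k).
  move=> kN; rewrite -bs// /bend; field.
  by rewrite gt_eqF ?den.
have bp' k : (k <= N)%N -> s k / ((1 - s k) * e + 1) = breakpoint A k.
  move=> kN; rewrite bp// -bs// /bend; field.
  by rewrite e10 gt_eqF ?den.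
move=> i; have [s0 s1] := partial_weight_bounds i hq.
have -> : \sum_(j < N | (j <= i)%N) q j = s i.+1 by [].
have sS : s i.+1 = s i + q i by rewrite /s big_ord_ltn_recr.
have iN := ltnW (ltn_ord i).
have c1 := adm_A10 hA i; have d1 := den i iN; have d2 := den i.+1 (ltn_ord i).
have a11 := adm_normalized hA i.
have ac : A i 0 0 * e + A i 1 0 = e * (1 + e * breakpoint A i).
  by rewrite -{2}(hf i) /next_param (breakpoint_ord A) divfK// gt_eqF// -breakpoint_ord.
have ab : A i 0 0 + breakpoint A i = breakpoint A i.+1 * (A i 1 0 + 1).
  rewrite (breakpointS hA) breakpoint_ord /moebius !mulr1 a11 divfK//.
  by rewrite gt_eqF.
have bp'0 := bp' _ iN; move: ac ab; rewrite -(bp' _ iN) -(bp' _ (ltn_ord i)).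
rewrite -/(s i) in s0 s1 *.
have D1 : 0 < (1 - s i) * e + 1.
  by rewrite bp// divr_gt0//; lra.
have D2 : 0 < (1 - s i.+1) * e + 1.
  by rewrite bp// divr_gt0//; lra.
move: D2; rewrite sS; move: (s i) s0 s1 D1 bp'0 => r r0 r1 D1 bp'0 D2 ac ab.
have a10 : A i 1 0 = e * (1 + e * (r / ((1 - r) * e + 1))) - A i 0 0 * e.
  by rewrite -ac; ring.
have f1 : 1 + e * ((r + q i) / ((1 - (r + q i)) * e + 1)) =
    (1 + e) / ((1 - (r + q i)) * e + 1) by field; rewrite gt_eqF.
have a00 : A i 0 0 = (q i + e * (r + q i)) / ((1 - r) * e + 1).
  have f0 : (1 + e) / ((1 - (r + q i)) * e + 1) != 0.
    by rewrite mulf_neq0 ?invr_eq0// gt_eqF.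
  (* Eliminating [A i 1 0] leaves [A i 0 0] multiplied by [1 + e * breakpoint A i.+1], which [f1]
     evaluates and [f0] shows to be nonzero. *)
  apply: (mulIf f0); rewrite -{1}f1.
  have -> : forall x y : R, x * (1 + e * y) = x + y * (x * e) by move=> *; ring.
  rewrite (_ : A i 0 0 * e = e * (1 + e * (r / ((1 - r) * e + 1))) - A i 1 0);
    last by rewrite -ac; ring.
  rewrite -[A i 0 0](addrK (r / ((1 - r) * e + 1))) ab.
  by field; rewrite !gt_eqF.
split => //; first by rewrite -breakpoint_ord -bp'0.
rewrite a10 a00; field.
by rewrite gt_eqF.
Qed.

End Identities.

(** * Uniform bound on the two-digit affinity *)

Section UniformBound.
Context {R : realType} {N : nat}.
Variables (hN : (2 <= N)%N) (A : 'I_N -> 'M[R]_2) (q : 'I_N -> R).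
Hypotheses (hA : admissible hN A) (hq : positive_weights q).

Local Notation i0 := (digit_first hN).

Lemma cvg_sum_seq (I : Type) (r : seq I) (f : I -> R -> R) (x : R) :
  (forall i, f i t @[t --> x] --> f i x) ->
  \sum_(i <- r) f i t @[t --> x] --> \sum_(i <- r) f i x.
Proof.
move=> cf; elim: r => [|i r IH].
  rewrite big_nil (_ : (fun t => \sum_(i <- [::]) f i t) = fun=> 0).
    exact: cvg_cst.
  by apply/funext => t; rewrite big_nil.
rewrite big_cons
  (_ : (fun t => _) = (fun t => f i t + \sum_(i <- r) f i t)).
  exact: cvgD.
by apply/funext => t; rewrite big_cons.
Qed.

Lemma cvg_next_param i (x : R) : -1 < x ->
  next_param (A i) t @[t --> x] --> next_param (A i) x.
Proof.
move=> x1; have h := next_param_den_gt0 (adm_A01 hA i) x1.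
apply: cvgM.
  by apply: cvgD; [apply: cvgM; [exact: cvg_cst|exact: cvg_id]|exact: cvg_cst].
apply: cvgV; first by rewrite gt_eqF.
by apply: cvgD; [exact: cvg_cst|apply: cvgM; [exact: cvg_id|exact: cvg_cst]].
Qed.

Lemma cvg_cell_mass i (x : R) : -1 < x ->
  cell_mass (A i) t @[t --> x] --> cell_mass (A i) x.
Proof.
move=> x1; have h := next_param_den_gt0 (adm_A01 hA i) x1.
have k := cell_mass_den_gt0 (adm_normalized hA i) (adm_det_gt0 hA i)
  (adm_A01 hA i) (adm_A10 hA i) (adm_im1 hA i) x1.
have lin (u v : R) : u + t * v @[t --> x] --> u + x * v.
  by apply: cvgD; [exact: cvg_cst|apply: cvgM; [exact: cvg_id|exact: cvg_cst]].
apply: cvgM.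
  by apply: cvgM; [apply: cvgD; [exact: cvg_cst|exact: cvg_id]|exact: cvg_cst].
by apply: cvgV; [rewrite gt_eqF ?mulr_gt0|exact: cvgM].
Qed.

Lemma cvg_affinity n (x : R) : -1 < x ->
  affinity A q n t @[t --> x] --> affinity A q n x.
Proof.
elim: n x => [|n IH] x x1 /=; first exact: cvg_cst.
apply: cvg_sum_seq => i; apply: cvgM.
  apply: (@cvg_comp _ _ _ (fun t => cell_mass (A i) t * q i) Num.sqrt _
    (nbhs (cell_mass (A i) x * q i))).
    by apply: cvgM; [exact: cvg_cell_mass|exact: cvg_cst].
  exact: sqrt_continuous.
apply: (@cvg_comp _ _ _ (next_param (A i)) (affinity A q n) _
  (nbhs (next_param (A i) x))); first exact: cvg_next_param.
exact/IH/(adm_next_param_gtN1 hA).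
Qed.

Lemma cell_mass_first_mono s t : -1 < s -> s < t ->
  cell_mass (A i0) s < cell_mass (A i0) t.
Proof.
move=> s1 st; rewrite !(cell_mass_first hA)//; last exact: lt_trans st.
exact/bend_param_mono/st/s1/(breakpoint1_gt0_lt1 hA).
Qed.

Lemma cell_mass_first_surj (y : R) : 0 < y < 1 ->
  exists2 x, -1 < x & cell_mass (A i0) x = y.
Proof.
move=> /andP[y0 y1]; have /andP[b0 b1] := breakpoint1_gt0_lt1 hA.
set b := breakpoint A 1 in b0 b1 *.
have d0 : 0 < b * (1 - y) by rewrite mulr_gt0//; lra.
(* The witness is the solution [t] of [bend t b = y]. *)
have x1 : -1 < (y - b) / (b * (1 - y)).
  have : 0 < y * (1 - b) by rewrite mulr_gt0//; lra.
  by rewrite ltr_pdivlMr//; lra.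
exists ((y - b) / (b * (1 - y))) => //.
have e1 : 1 + (y - b) / (b * (1 - y)) * b = (1 - b) / (1 - y).
  by field; rewrite !gt_eqF//; lra.
have e2 : 1 + (y - b) / (b * (1 - y)) = y * (1 - b) / (b * (1 - y)).
  by field; rewrite !gt_eqF//; lra.
rewrite (cell_mass_first hA)// /bend -/b e1 e2; field.
by rewrite !gt_eqF//; lra.
Qed.

Hypothesis ha0 : A i0 0 0 < 1.
Hypothesis hid : ~ coefficient_identities A (A i0 1 0 / (1 - A i0 0 0)) q.

Let q0 i : 0 < q i. Proof. by case: hq => /(_ i)/andP[]. Qed.

Let affinity1_lt1 i t : -1 < t -> cell_mass (A i) t != q i ->
  affinity A q 1 t < 1.
Proof.
move=> t1 h; apply: (le_lt_trans (affinity1_le hA hq i t1)).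
by rewrite gtrBl divr_gt0// exprn_even_gt0// subr_eq0.
Qed.

(** Equality would force the one-digit affinity to be 1 at [x], so all slopes at [x] are the [q i],
    and also at each next parameter [y], so the first slope at [y] is again [q i0]. Strict
    monotonicity of the first slope gives [y = x], and the identities follow. *)
Lemma affinity2_lt1 x : -1 < x -> cell_mass (A i0) x = q i0 ->
  affinity A q 2 x < 1.
Proof.
move=> x1 x0; have [//|ge1] := ltP (affinity A q 2 x) 1; exfalso; apply: hid.
have cm i : cell_mass (A i) x = q i.
  apply/eqP/negPn/negP => /affinity1_lt1 => /(_ x1).
  by rewrite ltNge (le_trans ge1)// (affinity2_le1 hA hq).
have np i : next_param (A i) x = x.
  set y := next_param (A i) x.
  have y1 : -1 < y by exact: adm_next_param_gtN1 hA i _ x1.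
  have : cell_mass (A i0) y = q i0.
    apply/eqP/negPn/negP => /affinity1_lt1 => /(_ y1) lt1.
    move: ge1; apply/negP; rewrite -ltNge.
    apply: (lt_le_trans _ (affinity1_le1 hA hq x1)).
    rewrite affinity1E [affinity _ _ _ _]/= (bigD1 i)//= [ltRHS](bigD1 i)//=.
    apply: ltr_leD.
      rewrite gtr_pMr//; last by rewrite sqrtr_gt0 mulr_gt0// cm.
    apply: ler_sum => j _; rewrite ler_piMr ?sqrtr_ge0//.
    exact/(affinity1_le1 hA hq)/(adm_next_param_gtN1 hA).
  rewrite -x0; have [||//] := ltgtP x y.
    by move=> /(cell_mass_first_mono x1)/lt_eqF; rewrite eq_sym => /eqP.
  by move=> /(cell_mass_first_mono y1)/lt_eqF/eqP.
have xE : x = A i0 1 0 / (1 - A i0 0 0).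
  have := np i0; rewrite (next_param_first hA) => h.
  have a1 : 1 - A i0 0 0 != 0 by rewrite gt_eqF// subr_gt0.
  by apply: (mulIf a1); rewrite divfK//; lra.
rewrite -xE; exact: identities_of_fixed_param.
Qed.

(** The parameter range is not compact. Continuity gives the bound near [x]; on either side,
    monotonicity keeps the first slope away from [q i0] by at least [m1] or [m2]. *)
Lemma affinity2_bound : exists2 theta : R, 0 <= theta < 1 &
  forall t, -1 < t -> affinity A q 2 t <= theta.
Proof.
have [x x1 cx] : exists2 x, -1 < x & cell_mass (A i0) x = q i0.
  by apply: cell_mass_first_surj; case: hq => /(_ i0).
have lt1 := affinity2_lt1 x1 cx.
set th1 := (1 + affinity A q 2 x) / 2.
have lt_th1 : affinity A q 2 x < th1 by rewrite /th1; lra.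
have /nbhs_ballP[d /= d0 hd] : \forall t \near x, affinity A q 2 t < th1.
  exact: (cvgr_lt _ (@cvg_affinity 2 x x1)) lt_th1.
(* Small enough to stay inside the ball given by continuity and to keep [x - d'] above -1. *)
pose d' := Num.min (d / 2) ((x + 1) / 2).
have d'0 : 0 < d' by rewrite lt_min; apply/andP; split; lra.
have d'd : d' <= d / 2 by rewrite ge_min lexx.
have d'x : d' <= (x + 1) / 2 by rewrite ge_min lexx orbT.
pose m1 := q i0 - cell_mass (A i0) (x - d').
pose m2 := cell_mass (A i0) (x + d') - q i0.
have xd1 : -1 < x - d' by lra.
have m10 : 0 < m1 by rewrite subr_gt0 -cx cell_mass_first_mono//; lra.
have m20 : 0 < m2 by rewrite subr_gt0 -cx cell_mass_first_mono//; lra.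
pose th2 := 1 - m1 ^+ 2 / 8; pose th3 := 1 - m2 ^+ 2 / 8.
have th10 : 0 <= th1.
  by have := affinity_ge0 A q 2 x; rewrite /th1; lra.
exists (Num.max th1 (Num.max th2 th3)).
  rewrite le_max th10/= !gt_max; apply/and3P; split.
  - by rewrite /th1; lra.
  - by rewrite gtrBl divr_gt0// exprn_gt0.
  - by rewrite gtrBl divr_gt0// exprn_gt0.
move=> t t1; rewrite !le_max.
have le12 := le_trans (affinity2_le1 hA hq t1) (affinity1_le hA hq i0 t1).
have cm_le u v : -1 < u -> u <= v ->
    cell_mass (A i0) u <= cell_mass (A i0) v.
  by move=> u1; rewrite le_eqVlt => /predU1P[->//|/(cell_mass_first_mono u1)/ltW].
have sqr_le m : 0 < m -> m <= `|cell_mass (A i0) t - q i0| ->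
    1 - (cell_mass (A i0) t - q i0) ^+ 2 / 8 <= 1 - m ^+ 2 / 8.
  move=> m0 mle; rewrite lerD2l lerN2 ler_pM2r// -[leRHS]real_normK ?num_real//.
  by rewrite lerXn2r ?nnegrE ?normr_ge0 ?(ltW m0).
have [tx|tx] := leP t (x - d').
  apply/orP; right; apply/orP; left; apply: (le_trans le12).
  apply: sqr_le => //; rewrite distrC (le_trans _ (ler_norm _))// lerD2l lerN2.
  exact: cm_le.
have [xt|xt] := leP (x + d') t.
  apply/orP; right; apply/orP; right; apply: (le_trans le12).
  apply: sqr_le => //; rewrite (le_trans _ (ler_norm _))// lerD2r.
  by apply: cm_le => //; lra.
apply/orP; left; apply/ltW; apply: hd; rewrite /ball/= ltr_norml.
by apply/andP; split; lra.
Qed.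

End UniformBound.

(** * Criteria for mutual singularity *)

Section Singular.
Context {R : realType}.
Implicit Types mu nu : probability (measurableTypeR R) R.

(** Borel-Cantelli: for summable errors the upper limit of the sets is [mu]-null. Its complement is
    a countable union of sets, each inside the complements of all late [B k] and hence [nu]-null. *)
Lemma mutually_singular_approx mu nu :
  (forall e : R, 0 < e -> exists B : set (measurableTypeR R),
    [/\ measurable B, (mu B <= e%:E)%E & (nu (~` B) <= e%:E)%E]) ->
  mutually_singular mu nu.
Proof.
move=> h; pose eps n : R := 1 / (2 ^ n.+1)%:R.
have eps0 n : 0 < eps n by rewrite divr_gt0// ltr0n expn_gt0.
have /choice[B HB] : forall n, exists B : set (measurableTypeR R),
    [/\ measurable B, (mu B <= (eps n)%:E)%E & (nu (~` B) <= (eps n)%:E)%E].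
  by move=> n; exact: h.
have mB n : measurable (B n) by case: (HB n).
exists (lim_sup_set B); split.
- by apply: bigcap_measurable => // k _; exact: bigcup_measurable.
- apply: lim_sup_set_cvg0 => //.
  apply: (@le_lt_trans _ _ 1%E); last exact: ltry.
  apply: (le_trans _ (epsilon_trick0 xpredT (@ler01 R))).
  by apply: lee_nneseries => // n _; case: (HB n).
- rewrite /lim_sup_set setC_bigcap; apply: measure_negligible.
    apply: bigcup_measurable => k _; apply: measurableC.
    exact: bigcup_measurable.
  apply: negligible_bigcup => n; apply/negligibleP.
    by apply: measurableC; exact: bigcup_measurable.
  rewrite setC_bigcup; apply/eqP; rewrite eq_le measure_ge0 andbT.
  apply/lee_addgt0Pr => e e0; rewrite add0e.
  have [k0 _ /(_ (n + k0)%N) /= hk] := near_infty_natSinv_expn_lt (PosNum e0).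
  apply: (@le_trans _ _ (nu (~` B (n + k0)%N))).
    apply: le_measure; rewrite ?inE.
    + by apply: bigcap_measurable => [|k _]; [exists n => /=|exact: measurableC].
    + exact: measurableC.
    + by apply: bigcap_inf => /=; exact: leq_addr.
  case: (HB (n + k0)%N) => _ _ /le_trans; apply.
  rewrite lee_fin (le_trans _ (ltW (hk (leq_addl _ _))))//.
  rewrite /eps ler_pM2l// lef_pV2 ?posrE ?ltr0n ?expn_gt0// ?exprn_gt0//.
  by rewrite -natrX ler_nat leq_exp2l.
Qed.

Lemma measure_bigsetU_le mu (I : Type) (s : seq I) (P : pred I)
    (F : I -> set (measurableTypeR R)) : (forall i, measurable (F i)) ->
  (mu (\big[setU/set0]_(i <- s | P i) F i) <= \sum_(i <- s | P i) mu (F i))%E.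
Proof.
move=> mF; elim: s => [|i s IH]; first by rewrite !big_nil measure0.
rewrite !big_cons; case: (P i) => //.
have mb : measurable (\big[setU/set0]_(j <- s | P j) F j).
  exact: bigsetU_measurable.
apply: le_trans; first exact: (measureU2 mu (mF i) mb).
exact: leeD2l.
Qed.

(* Collect the cells on which [mu] has less mass than [nu]: both [mu] of their
   union and [nu] of its complement are at most the Hellinger affinity. *)
Lemma mutually_singular_cells mu nu (T : set (measurableTypeR R)) (I : choiceType)
    (M V : I -> R) (C : I -> set (measurableTypeR R)) :
  measurable T -> nu T = 1%E ->
  (forall i, measurable (C i)) ->
  (forall i, mu (C i) = (M i)%:E) -> (forall i, nu (C i) = (V i)%:E) ->
  (forall e : R, 0 < e -> exists s : seq I,
    (forall x, T x -> exists2 i, i \in s & C i x) /\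
    \sum_(i <- s) Num.sqrt (M i * V i) <= e) ->
  mutually_singular mu nu.
Proof.
move=> mT nuT mC muC nuC h; apply: mutually_singular_approx => e e0.
have [s [cover se]] := h e e0.
have M0 i : 0 <= M i by rewrite -lee_fin -muC.
have V0 i : 0 <= V i by rewrite -lee_fin -nuC.
have min_le x y : 0 <= x -> x <= y -> x <= Num.sqrt (x * y).
  move=> x0 xy; rewrite -[leLHS]ger0_norm// -sqrtr_sqr expr2 ler_sqrt.
    exact: ler_wpM2l.
  by rewrite mulr_ge0// (le_trans x0).
exists (\big[setU/set0]_(i <- s | M i <= V i) C i); split.
- exact: bigsetU_measurable.
- apply: (le_trans (measure_bigsetU_le _ _ _ mC)).
  rewrite (eq_bigr (fun i => (M i)%:E)) => [|i _]; last exact: muC.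
  rewrite sumEFin lee_fin (le_trans _ se)// [leRHS](bigID (fun i => M i <= V i))/=.
  rewrite ler_wpDr ?sumr_ge0//.
  by apply: ler_sum => i MV; exact: min_le.
(* A point of [T] outside the chosen cells lies in a covering cell with [V i < M i], and [nu] gives
   no mass to the complement of [T]. *)
- apply: (@le_trans _ _ (nu (~` T `|` \big[setU/set0]_(i <- s | ~~ (M i <= V i)) C i))).
    apply: le_measure; rewrite ?inE.
    + by apply: measurableC; exact: bigsetU_measurable.
    + by apply: measurableU; [exact: measurableC|exact: bigsetU_measurable].
    + move=> x nx; have [Tx|] := pselect (T x); last by left.
      right; have [i si Cix] := cover x Tx.
      move: nx; rewrite -!bigcup_seq_cond => nx; exists i => //=.
      by rewrite si/=; apply/negP => MV; apply: nx; exists i => //=; rewrite si.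
  have mb : measurable (\big[setU/set0]_(i <- s | ~~ (M i <= V i)) C i).
    exact: bigsetU_measurable.
  have nTC : nu (~` T) = 0%E by rewrite probability_setC// nuT subee.
  apply: (@le_trans _ _
      (0 + nu (\big[setU/set0]_(i <- s | ~~ (M i <= V i)%R) C i))%E).
    by rewrite -nTC; exact: (measureU2 nu (measurableC mT) mb).
  rewrite add0e; apply: (le_trans (measure_bigsetU_le _ _ _ mC)).
  rewrite (eq_bigr (fun i => (V i)%:E)) => [|i _]; last exact: nuC.
  rewrite sumEFin lee_fin (le_trans _ se)// [leRHS](bigID (fun i => M i <= V i))/=.
  rewrite ler_wpDl ?sumr_ge0//.
  apply: ler_sum => i; rewrite -ltNge => /ltW VM; rewrite mulrC; exact: min_le.
Qed.

End Singular.

(** * Distribution functions of measures on the unit interval *)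

Section UnitInterval.
Context {R : realType} (mu : probability (measurableTypeR R) R).
Hypothesis on01 : on_unit_interval mu.

Lemma unit_interval_cdf_lt0 x : x < 0 -> mu `]-oo, x]%classic = 0%E.
Proof.
move=> x0; apply/eqP; rewrite eq_le measure_ge0 andbT.
apply: (@le_trans _ _ (mu (~` `[0, 1]%classic))).
  apply: le_measure; rewrite ?inE//; first exact: measurableC.
  move=> y /=; rewrite !in_itv/= => yx /andP[y0 _].
  by have := le_lt_trans (le_trans y0 yx) x0; rewrite ltxx.
have mI : measurable (`[0, 1]%classic : set (measurableTypeR R)).
  exact: measurable_itv.
by rewrite (probability_setC mu mI) on01 subee.
Qed.

Lemma unit_interval_cdf_ge1 x : 1 <= x -> mu `]-oo, x]%classic = 1%E.
Proof.
move=> x1; apply/eqP; rewrite eq_le; apply/andP; split.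
  exact: probability_le1.
rewrite -on01; apply: le_measure; rewrite ?inE// => y /=.
by rewrite !in_itv/= => /andP[_ /le_trans]; apply.
Qed.

Lemma measure_ocitv_cdf (F : R -> R) x y :
  (forall z, mu `]-oo, z]%classic = (F z)%:E) -> x <= y ->
  mu `]x, y]%classic = (F y - F x)%:E.
Proof.
move=> muF xy; rewrite EFinB -!muF.
have -> : `]x, y]%classic = `]-oo, y] `\` `]-oo, x] :> set R.
  by rewrite -[RHS]setCK setCD setCitvl setUC -[LHS]setCK setCitv.
rewrite measureD ?setIidr//; first exact: subset_itvl.
by rewrite -ge0_fin_numE// fin_num_measure.
Qed.

(** Composing with this retraction extends a distribution function known only on [0, 1] to the whole
    line. *)
Definition clamp01 x : R := Num.max 0 (Num.min x 1).

Lemma clamp01_unit x : 0 <= clamp01 x <= 1.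
Proof. by rewrite /clamp01 le_max lexx ge_max ler01 ge_min lexx orbT. Qed.

Lemma clamp01_id x : 0 <= x <= 1 -> clamp01 x = x.
Proof. by move=> /andP[x0 x1]; rewrite /clamp01 min_l// max_r. Qed.

Lemma unit_interval_cdf_clamp (F : R -> R) x :
  (forall z, 0 <= z <= 1 -> mu `]-oo, z]%classic = (F z)%:E) -> F 0 = 0 ->
  mu `]-oo, x]%classic = (F (clamp01 x))%:E.
Proof.
move=> muF F0; have [x0|x0] := ltP x 0.
  rewrite unit_interval_cdf_lt0// /clamp01 min_l ?max_l ?F0// ltW//.
  exact: lt_trans ltr01.
have [x1|x1] := leP x 1; first by rewrite clamp01_id ?x0// muF ?x0.
rewrite unit_interval_cdf_ge1 ?ltW// /clamp01 min_r ?max_r ?ltW//.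
by rewrite -muF ?ler01 ?lexx// unit_interval_cdf_ge1.
Qed.

Lemma unit_interval_ocitv (F : R -> R) x y :
  (forall z, 0 <= z <= 1 -> mu `]-oo, z]%classic = (F z)%:E) -> F 0 = 0 ->
  x <= y -> mu `]x, y]%classic = (F (clamp01 y) - F (clamp01 x))%:E.
Proof.
move=> muF F0; apply: (measure_ocitv_cdf (F := F \o clamp01)) => z.
exact: unit_interval_cdf_clamp.
Qed.

End UnitInterval.

(** * N-adic cells and self-similar measures *)

Section Cells.
Context {R : realType} {N : nat}.
Hypothesis N0 : (0 < N)%N.
Implicit Types (w : seq 'I_N) (x : R).

Definition word_point w x : R := foldr (fun (i : 'I_N) z => (z + i%:R) / N%:R) x w.

(** Open on the left, so that its mass is exactly a difference of two values of the distribution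
    function; the point 0 is left out. *)
Definition word_cell w : set (measurableTypeR R) :=
  `]word_point w 0, word_point w 1]%classic.

Let NR : 0 < N%:R :> R. Proof. by rewrite ltr0n. Qed.

Lemma digit_point_itv (i : 'I_N) x : 0 <= x <= 1 ->
  i%:R / N%:R <= (x + i%:R) / N%:R <= i.+1%:R / N%:R.
Proof.
move=> /andP[x0 x1]; rewrite !ler_pM2r ?invr_gt0// lerDr x0/=.
by rewrite -nat1r lerD2r.
Qed.

Lemma digit_point_unit (i : 'I_N) x : 0 <= x <= 1 ->
  0 <= (x + i%:R) / N%:R <= 1.
Proof.
move=> /(digit_point_itv i)/andP[h1 h2]; apply/andP; split.
  by apply: le_trans h1; rewrite divr_ge0 ?ler0n.
by apply: (le_trans h2); rewrite ler_pdivrMr// mul1r ler_nat.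
Qed.

Lemma word_point_unit w x : 0 <= x <= 1 -> 0 <= word_point w x <= 1.
Proof. by elim: w => //= i w IH /IH; exact: digit_point_unit. Qed.

Lemma word_point_le w x y : x <= y -> word_point w x <= word_point w y.
Proof.
elim: w => //= i w IH /IH h.
by rewrite ler_pM2r ?invr_gt0// lerD2r.
Qed.

Lemma word_cell_cons (i : 'I_N) w x :
  word_cell w (N%:R * x - i%:R) -> word_cell (i :: w) x.
Proof.
rewrite /word_cell /= !in_itv/= ltrBrDr lerBlDr => /andP[h1 h2].
by rewrite ltr_pdivrMr// ler_pdivlMr// ![x * _]mulrC h1.
Qed.

Lemma digit_point_surj x : 0 < x <= 1 ->
  exists i : 'I_N, exists2 y, 0 < y <= 1 & x = (y + i%:R) / N%:R.
Proof.
move=> /andP[x0 x1].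
(* The digit is the ceiling of [N * x] minus 1 rather than the floor, matching cells closed on the
   right. *)
have ex : exists k, N%:R * x <= k%:R by exists N; rewrite ler_piMr// ltW.
case: (ex_minnP ex) => -[|k] hk kmin.
  by move: hk; rewrite leNgt mulr_gt0.
have kN : (k < N)%N by apply: kmin; rewrite ler_piMr// ltW.
have kx : k%:R < N%:R * x.
  by rewrite ltNge; apply/negP => /kmin; rewrite ltnn.
exists (Ordinal kN), (N%:R * x - k%:R).
  by rewrite subr_gt0 kx/= lerBlDl natr1.
by rewrite subrK mulrC mulKf// gt_eqF.
Qed.

Lemma word_cell_cover n x : 0 < x <= 1 ->
  exists2 w : seq 'I_N, w \in words n & word_cell w x.
Proof.
elim: n x => [|n IH] x x01.
  by exists [::]; rewrite ?inE// /word_cell /= in_itv.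
have [i [y y01 ->]] := digit_point_surj x01.
have [w ww wy] := IH y y01.
exists (i :: w); first by apply/allpairsP; exists (i, w); rewrite mem_enum.
by apply: word_cell_cons; rewrite mulrC divfK ?gt_eqF// addrK.
Qed.

Lemma measurable_word_cell w : measurable (word_cell w).
Proof. exact: measurable_itv. Qed.

Lemma measure_word_cell (mu : probability (measurableTypeR R) R) (F : R -> R) w :
  on_unit_interval mu ->
  (forall x, 0 <= x <= 1 -> mu `]-oo, x]%classic = (F x)%:E) -> F 0 = 0 ->
  mu (word_cell w) = (F (word_point w 1) - F (word_point w 0))%:E.
Proof.
move=> hmu muF F0; rewrite (unit_interval_ocitv hmu muF)//.
  by rewrite !clamp01_id// word_point_unit ?ler01 ?lexx.
exact/word_point_le/ler01.
Qed.

Section SelfSimilar.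
Variables (q : 'I_N -> R) (nu : probability (measurableTypeR R) R).
Hypotheses (hq : positive_weights q) (hnu : self_similar q nu).

Let F x : R := fine (nu `]-oo, x]%classic).

Let FE x : nu `]-oo, x]%classic = (F x)%:E.
Proof. by rewrite /F fineK// fin_num_measure. Qed.

Let F_lt0 x : x < 0 -> F x = 0.
Proof.
by move=> x0; apply: EFin_inj; rewrite -FE unit_interval_cdf_lt0//; case: hnu.
Qed.

Let F_ge1 x : 1 <= x -> F x = 1.
Proof.
by move=> x1; apply: EFin_inj; rewrite -FE unit_interval_cdf_ge1//; case: hnu.
Qed.

Let F_self x : F x = \sum_(i < N) q i * F (N%:R * x - i%:R).
Proof.
apply: EFin_inj; rewrite -FE; case: hnu => _ ->; last exact: measurable_itv.
rewrite -sumEFin; apply: eq_bigr => i _; rewrite EFinM -FE; congr (_ * nu _)%E.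
apply/seteqP; split => y /=; rewrite !in_itv/= /similitude;
by rewrite ler_pdivrMr// -lerBrDr mulrC.
Qed.

(** There is no atom at 0: there the self-similarity equation keeps only the digit 0 and reads
    [F 0 = q_0 * F 0] with [q_0 < 1]. *)
Let F0 : F 0 = 0.
Proof.
have := F_self 0; rewrite (bigD1 (Ordinal N0))//= big1 => [|i i0'].
  rewrite mulr0 subr0 addr0 => h.
  have : (1 - q (Ordinal N0)) * F 0 = 0 by rewrite mulrBl mul1r -h subrr.
  have q1 : q (Ordinal N0) < 1 by case: hq => /(_ (Ordinal N0))/andP[].
  by move=> /eqP; rewrite mulf_eq0 subr_eq0 gt_eqF//= => /eqP.
rewrite mulr0 sub0r F_lt0 ?mulr0// oppr_lt0 ltr0n lt0n.
by apply: contraNneq i0' => i0E; apply/eqP/val_inj.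
Qed.

Lemma self_similar_cdf : exists F : R -> R,
  [/\ forall x, nu `]-oo, x]%classic = (F x)%:E, F 0 = 0, F 1 = 1 &
      forall (i : 'I_N) x, 0 <= x <= 1 ->
        F ((x + i%:R) / N%:R) = \sum_(j < N | (j < i)%N) q j + q i * F x].
Proof.
exists F; split=> //; first exact: F_ge1.
move=> i x /andP[x0 x1]; rewrite F_self mulrC divfK ?gt_eqF//.
rewrite (bigID (fun j : 'I_N => (j < i)%N))/=; congr (_ + _).
  apply: eq_bigr => j ji; rewrite F_ge1 ?mulr1//.
  rewrite -addrA -natrB ?(ltnW ji)// ler_wpDl// ler1n subn_gt0//.
rewrite (bigD1 i) ?ltnn//= addrK big1 ?addr0// => j /andP[ji nji].
have ij : (i < j)%N.
  by rewrite ltn_neqAle leqNgt ji andbT eq_sym -val_eqE in nji *.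
have : x + i%:R - j%:R <= 0.
  rewrite subr_le0 (le_trans (_ : _ <= 1 + i%:R))// ?lerD2r//.
  by rewrite nat1r ler_nat.
(* The argument is 0 when [x = 1] and [j = i + 1]; that case rests on the absence of an atom at
   0. *)
by rewrite le_eqVlt => /predU1P[->|/F_lt0->]; rewrite ?F0 mulr0.
Qed.

Lemma self_similar_word_cell w : nu (word_cell w) = (word_weight q w)%:E.
Proof.
have [G [GE G0 G1 Gself]] := self_similar_cdf.
rewrite (@measure_word_cell nu G)//; last by case: hnu.
congr EFin; elim: w => [|i w IH] /=.
  by rewrite G0 G1 subr0 /word_weight big_nil.
rewrite !Gself ?word_point_unit ?lexx ?ler01// /word_weight big_cons.
by rewrite -/(word_weight q w) -IH opprD addrACA subrr add0r -mulrBr.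
Qed.

End SelfSimilar.
End Cells.

(** * Absolute continuity from a comparison on half-open intervals *)

Section Domination.
Context {R : realType}.
Implicit Types mu nu : probability (measurableTypeR R) R.

Lemma probability_stieltjes nu : exists f : cumulative R R,
  forall A : set (measurableTypeR R), measurable A ->
    lebesgue_stieltjes_measure f A = nu A.
Proof. by eexists => A mA; exact: lebesgue_stieltjes_cdf_id. Qed.

(** As a Lebesgue-Stieltjes measure, [nu] is given on Borel sets by the outer measure built from
    half-open intervals, an infimum over countable covers. *)
Lemma null_set_ocitv_cover nu (A : set (measurableTypeR R)) (e : R) :
  measurable A -> nu A = 0%E -> 0 < e ->
  exists I : (set (measurableTypeR R))^nat,
    [/\ forall k, ocitv (I k), A `<=` \bigcup_k I k &
        (\sum_(k <oo) nu (I k) <= e%:E)%E].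
Proof.
move=> mA A0 e0; have [f fE] := probability_stieltjes nu.
have extE X : ocitv X -> wlength f X = nu X.
  move=> oX; have mX : measurable (X : set (measurableTypeR R)).
    by case: oX => -[a b] _ <-; exact: measurable_itv.
  by rewrite -fE// /lebesgue_stieltjes_measure /measure_extension/=
    measurable_mu_extE.
have ext0 : mu_ext (wlength f) A = 0%E by rewrite -A0 -fE.
have [x [I [mI AI] <-] le_e] : exists2 x : \bar R,
    [set (\sum_(k <oo) wlength f (B k))%E |
      B in measurable_cover (A : set (ocitv_type R))] x &
    (x < mu_ext (wlength f) A + e%:E)%E.
  apply: lb_ereal_inf_adherent => //.
  by have := ext0; rewrite /mu_ext => ->.
move: le_e; rewrite ext0 add0e => /ltW le_e.
exists I; split => //.
by apply: le_trans le_e; rewrite le_eqVlt; apply/orP; left; apply/eqP;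
  apply: eq_eseriesr => k _; rewrite extE//; exact: mI.
Qed.

(** A [nu]-null set is covered by intervals of total [nu]-mass at most [e / C], hence of total
    [mu]-mass at most [e]. *)
Lemma null_dominates_ocitv mu nu (C : R) : 0 < C ->
  (forall a b, a <= b -> (mu `]a, b]%classic <= C%:E * nu `]a, b]%classic)%E) ->
  mu `<< nu.
Proof.
move=> C0 h; apply/null_content_dominatesP => A mA A0.
apply/eqP; rewrite eq_le measure_ge0 andbT.
apply/lee_addgt0Pr => e e0; rewrite add0e.
have [I [oI AI sI]] := null_set_ocitv_cover mA A0 (divr_gt0 e0 C0).
have mI k : measurable (I k : set (measurableTypeR R)).
  by case: (oI k) => -[a b] _ <-; exact: measurable_itv.
apply: le_trans.
  exact: (measure_sigma_subadditive mu mI mA AI).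
apply: (@le_trans _ _ (C%:E * \sum_(k <oo) nu (I k))%E); last first.
  rewrite (le_trans (lee_wpmul2l _ sI)) ?lee_fin ?(ltW C0)//.
  by rewrite mulrC divfK// gt_eqF.
rewrite -nneseriesZl ?(ltW C0)//.
apply: lee_nneseries => // k _; case: (oI k) => -[a b] _ /= <-.
have [ab|ba] := leP a b; first exact: h.
by rewrite set_itv_ge ?measure0 ?mule0// bnd_simp -leNgt ltW.
Qed.

End Domination.

Lemma expr_small (R : realType) (r e : R) : 0 <= r < 1 -> 0 < e ->
  exists n, r ^+ n < e.
Proof.
move=> /andP[r0 r1] e0.
have : r ^+ n @[n --> \oo] --> (0 : R) by apply: cvg_expr; rewrite ger0_norm.
move=> /cvgr_lt/(_ _ e0)[n _ /(_ n (leqnn n))] rn.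
by exists n.
Qed.

(** * The measure of the solution: singularity and domination *)

Section Solution.
Context {R : realType} {N : nat}.
Variables (hN : (2 <= N)%N) (A : 'I_N -> 'M[R]_2).
Variables (phi : R -> R) (mu : probability (measurableTypeR R) R).
Hypotheses (hA : admissible hN A) (hphi : continuous_solution A phi).
Hypothesis hmu : has_distribution_function mu phi.

Local Notation i0 := (digit_first hN).
Let N0 : (0 < N)%N. Proof. exact: ltnW hN. Qed.
Let u0 : 0 <= (0 : R) <= 1. Proof. by rewrite lexx ler01. Qed.
Let u1 : 0 <= (1 : R) <= 1. Proof. by rewrite lexx ler01. Qed.

Lemma solution1 : phi 1 = 1.
Proof.
case: hmu => on01 muphi; apply: EFin_inj.
by rewrite -muphi// unit_interval_cdf_ge1.
Qed.

Lemma solution_digit (i : 'I_N) x : 0 <= x <= 1 ->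
  phi ((x + i%:R) / N%:R) = moebius (A i) (phi x).
Proof.
move=> x01; rewrite (sol_eq hphi (i := i)) ?digit_point_itv//.
by rewrite mulrC divfK ?addrK// pnatr_eq0 -lt0n.
Qed.

(** Masses are read off at [t = 0], but each digit changes the parameter, so the induction runs over
    all [t]. *)
Lemma bend_solution_word t w : -1 < t -> phi 0 = 0 ->
  bend t (phi (word_point w 1)) - bend t (phi (word_point w 0)) =
  word_mass A t w.
Proof.
move=> t1 phi0; elim: w t t1 => [|i w IH] t t1 /=.
  by rewrite phi0 solution1 bend0 bend1// subr0.
have n1 := adm_next_param_gtN1 hA i t1.
rewrite !solution_digit ?word_point_unit// -IH// mulrBr.
by rewrite -!(adm_bend_moebius hA) ?(sol_unit hphi) ?word_point_unit//; ring.
Qed.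

Hypothesis ha0 : A i0 0 0 < 1.

(** [phi 0] is a fixed point of the first map. Besides [y], the fixed-point equation has a factor
    affine in [y] that is positive at 0, as [A i0 0 0 < 1], and at 1, as the first map sends 1 below
    1. *)
Lemma solution0 : phi 0 = 0.
Proof.
have phi01 := sol_unit hphi u0.
have h : phi 0 = moebius (A i0) (phi 0).
  by rewrite -(solution_digit i0 u0) add0r mul0r.
have b0 : A i0 0 1 = 0 by rewrite -breakpoint_ord (breakpoint0 hA).
have a11 := adm_normalized hA i0.
have d0 := moebius_den_gt0 (adm_A10 hA i0) phi01.
have /andP[_ im1] := breakpoint1_gt0_lt1 hA.
move: im1; rewrite (breakpointS hA i0) /moebius !mulr1 a11 b0 addr0.
rewrite ltr_pdivrMr ?(adm_A10 hA)// mul1r => ac.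
move: h phi01 d0; rewrite /moebius b0 a11 addr0.
move: (phi 0) => y h /andP[y0 y1] d0.
have eq0 : y * (A i0 1 0 * y + 1 - A i0 0 0) = 0.
  have : y * (A i0 1 0 * y + 1) = A i0 0 0 * y.
    by rewrite {1}h divfK// gt_eqF.
  by lra.
have pos : 0 < A i0 1 0 * y + 1 - A i0 0 0.
  have -> : A i0 1 0 * y + 1 - A i0 0 0 =
    y * (A i0 1 0 + 1 - A i0 0 0) + (1 - y) * (1 - A i0 0 0) by ring.
  have [->|yn0] := eqVneq y 0; first by rewrite mul0r add0r subr0 mul1r subr_gt0.
  rewrite ltr_pwDl ?mulr_ge0 ?subr_ge0 ?(ltW ha0)// mulr_gt0 ?subr_gt0//.
  by rewrite lt_neqAle eq_sym yn0.
by move/eqP: eq0; rewrite mulf_eq0 (gt_eqF pos) orbF => /eqP.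
Qed.

Let muphi x : 0 <= x <= 1 -> mu `]-oo, x]%classic = (phi x)%:E.
Proof. by case: hmu => _; apply. Qed.

Let on01 : on_unit_interval mu. Proof. by case: hmu. Qed.

Lemma solution_word_cell w : mu (word_cell w) = (word_mass A 0 w)%:E.
Proof.
rewrite (measure_word_cell N0 _ on01 muphi solution0).
by rewrite -bend_solution_word ?ltrN10 ?solution0// !bend_param0.
Qed.

Lemma solution_singular (q : 'I_N -> R) nu :
  ~ coefficient_identities A (A i0 1 0 / (1 - A i0 0 0)) q ->
  positive_weights q -> self_similar q nu -> mutually_singular mu nu.
Proof.
move=> hid hq hnu.
have [theta th01 hth] := affinity2_bound hA hq ha0 hid.
have nuE := self_similar_word_cell N0 hq hnu.
apply: (@mutually_singular_cells _ mu nu (word_cell ([::] : seq 'I_N)) _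
  (word_mass A 0) (word_weight q) word_cell) => //.
- exact: measurable_word_cell.
- by have := nuE [::]; rewrite /word_weight big_nil.
- exact: measurable_word_cell.
- exact: solution_word_cell.
move=> e e0; have [n hn] := expr_small th01 e0.
exists (words n.*2); split.
  by move=> x; rewrite /word_cell /= in_itv/= => /(word_cell_cover N0 n.*2).
rewrite (sum_words_sqrt hA hq) ?ltrN10//.
by rewrite (le_trans _ (ltW hn))// (affinity_double_le hA) ?ltrN10.
Qed.

(* On [0, 1] the two functions solve the same equation, whose right-hand side
   contracts the difference by the factor [p i]. *)
Lemma self_similar_cdf_eq (p : 'I_N -> R) (e : R) (F : R -> R) : -1 < e ->
  positive_weights p ->
  (forall i, cell_mass (A i) e = p i) -> (forall i, next_param (A i) e = e) ->
  (forall x, 0 <= x <= 1 -> 0 <= F x <= 1) -> F 0 = 0 ->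
  (forall (i : 'I_N) x, 0 <= x <= 1 ->
    F ((x + i%:R) / N%:R) = \sum_(j < N | (j < i)%N) p j + p i * F x) ->
  forall x, 0 <= x <= 1 -> F x = bend e (phi x).
Proof.
move=> e1 [p01 _] hm hf F01 F0 Fself.
pose r := \big[Num.max/0]_(i < N) p i.
have pr i : p i <= r by exact: le_bigmax.
have r01 : 0 <= r < 1.
  rewrite (le_trans _ (pr i0)) /=; last by case/andP: (p01 i0) => /ltW.
  by apply: bigmax_lt => // i _; case/andP: (p01 i).
have bend01 y : 0 <= y <= 1 -> 0 <= bend e y <= 1.
  move=> y01; rewrite -{1}(bend0 e) -(bend1 e1) -subr_ge0 -[_ <= bend e 1]subr_ge0.
  have /andP[y0 y1] := y01.
  by rewrite !bendB// !divr_ge0 ?mulr_ge0 ?subr_ge0 ?(ltW (bend_den_gt0 _ _))//;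
    lra.
have bound n x : 0 <= x <= 1 -> `|F x - bend e (phi x)| <= r ^+ n.
  elim: n x => [|n IH] x x01.
    have /andP[? ?] := F01 x x01; have /andP[? ?] := bend01 _ (sol_unit hphi x01).
    by rewrite expr0 ler_norml; apply/andP; split; lra.
  (* The digit decomposition covers only positive points, so 0 is treated apart. *)
  have [->|xn0] := eqVneq x 0.
    rewrite F0 solution0 bend0 subrr normr0 exprn_ge0//.
    by case/andP: r01.
  have /andP[x0 x1] := x01.
  have [|i [y /andP[y0 y1] ->]] := digit_point_surj N0 (x := x).
    by rewrite lt_neqAle eq_sym xn0 x0.
  have y01 : 0 <= y <= 1 by rewrite (ltW y0).
  rewrite Fself// solution_digit// -(bend_breakpoint hA e1 hm (ltnW (ltn_ord i))).
  have := adm_bend_moebius hA i e1 (sol_unit hphi y01).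
  rewrite hf hm breakpoint_ord => /eqP; rewrite subr_eq addrC => /eqP ->.
  rewrite opprD addrACA subrr add0r -mulrBr normrM exprS ler_pM//; last exact: IH.
  by rewrite ger0_norm//; case/andP: (p01 i) => /ltW.
move=> x x01; apply/eqP; rewrite -subr_eq0 -normr_le0 leNgt; apply/negP => d0.
have [n] := expr_small r01 d0.
by rewrite ltNge bound.
Qed.

(** The distribution function of [nu] is [bend e] composed with [phi], so [bend_expansive] bounds
    the [mu]-mass of every half-open interval by [C] times its [nu]-mass. *)
Lemma solution_dominated (p : 'I_N -> R) nu :
  positive_weights p ->
  coefficient_identities A (A i0 1 0 / (1 - A i0 0 0)) p ->
  self_similar p nu -> mu `<< nu.
Proof.
move=> hp hid hnu; have e1 := first_param_gtN1 hA ha0.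
set e := A i0 1 0 / (1 - A i0 0 0) in e1 hid *.
have hfix := fixed_param_of_identities hA e1 hp hid.
have [F [FE F0 F1 Fself]] := self_similar_cdf N0 hp hnu.
have F01 x : 0 <= F x <= 1 by rewrite -!lee_fin -FE measure_ge0 probability_le1.
have Fphi : forall x, 0 <= x <= 1 -> F x = bend e (phi x).
  by apply: (self_similar_cdf_eq e1 hp) => // i; case: (hfix i).
have [C C0 hC] := bend_expansive e1.
apply: (null_dominates_ocitv C0) => a b ab.
have muab := unit_interval_ocitv on01 muphi solution0 ab.
have on01' : on_unit_interval nu by case: hnu.
have nuab := unit_interval_ocitv on01' (fun x _ => FE x) F0 ab.
have phi_le : phi (clamp01 a) <= phi (clamp01 b).
  by rewrite -subr_ge0 -lee_fin -muab.
rewrite muab nuab -EFinM lee_fin !Fphi ?clamp01_unit//.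
by apply: hC => //; apply: (sol_unit hphi); exact: clamp01_unit.
Qed.

End Solution.

Theorem proposition3p22 (R : realType) (N : nat) (hN : (2 <= N)%N)
    (A : 'I_N -> 'M[R]_2) (hA : admissible hN A)
    (phi : R -> R) (hphi : continuous_solution A phi)
    (mu_phi : probability (measurableTypeR R) R)
    (hmu : has_distribution_function mu_phi phi)
    (ha0 : A (digit_first hN) 0 0 < 1)
    (e0 : R)
    (he0 : e0 = A (digit_first hN) 1 0 / (1 - A (digit_first hN) 0 0)) :
  (forall p : 'I_N -> R,
     positive_weights p -> coefficient_identities A e0 p ->
     forall nu : probability (measurableTypeR R) R,
       self_similar p nu -> mu_phi `<< nu) /\
  (~ (exists p : 'I_N -> R,
        positive_weights p /\ coefficient_identities A e0 p) ->
   forall (q : 'I_N -> R) (nu : probability (measurableTypeR R) R),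
     positive_weights q -> self_similar q nu ->
     mutually_singular mu_phi nu).
Proof.
rewrite he0; split=> [p hp hid nu hnu|nex q nu hq hnu].
  exact: (solution_dominated hA hphi hmu ha0 hp hid hnu).
apply: (solution_singular hA hphi hmu ha0 _ hq hnu) => hid; apply: nex.
by exists q.
Qed.
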